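(* Let $n\ge 2$. The flat virtual braid group $FV_n$ has the following reduced presentation, with generators $c_1, v_1,\ldots,v_{n-1}$ (the elements of $FV_n$ of the same names) and defining relations: $$\begin{array}{l} v_i v_{i+1} v_i = v_{i+1} v_i v_{i+1},\\ v_i v_j = v_j v_i,\quad j\neq i\pm 1,\\ c_1^2=1,\quad v_i^2 = 1,\quad 1\le i\le n-1,\\ c_1 v_j = v_j c_1,\quad j>2,\\ (v_1c_1 v_1)(v_2c_1 v_2)(v_1c_1 v_1) = (v_2c_1 v_2)(v_1c_1 v_1)(v_2c_1 v_2),\\ c_1(v_2v_3v_1v_2c_1v_2v_1v_3v_2) = (v_2v_3v_1v_2c_1v_2v_1v_3v_2)c_1. \end{array}$$
   Context: The flat virtual braid group $FV_n$ is the group with generators $c_1,\ldots,c_{n-1}$ (flat generators) and $v_1,\ldots,v_{n-1}$ (virtual generators) and the following relations: flat relations $c_i^2=1$, $c_ic_{i+1}c_i=c_{i+1}c_ic_{i+1}$, and $c_ic_j=c_jc_i$ for $|i-j|\ge 2$; virtual relations $v_i^2=1$, $v_iv_{i+1}v_i=v_{i+1}v_iv_{i+1}$, and $v_iv_j=v_jv_i$ for $|i-j|\ge 2$; mixed flat relations $c_iv_j=v_jc_i$ for $|i-j|\ge 2$ and $v_ic_{i+1}v_i=v_{i+1}c_iv_{i+1}$. In $FV_n$ the other flat generators are expressed through the generators of the reduced presentation by $$c_{i+1} = (v_i\cdots v_2v_1)(v_{i+1}\cdots v_3v_2)\,c_1\,(v_2v_3\cdots v_{i+1})(v_1v_2\cdots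 v_i),\qquad 1\le i\le n-2.$$ In every presentation, a relation is included exactly when all indices occurring in it lie in $\{1,\ldots,n-1\}$. *)

(* Defs.v *)
From HB Require Import structures.
From mathcomp Require Import all_boot.
From mathcomp Require Import boolp.

Set Implicit Arguments.
Unset Strict Implicit.
Unset Printing Implicit Defensive.

Local Open Scope quotient_scope.

(* A word in the letters x^{+1}, written (x, true), and x^{-1}, written
   (x, false). *)
Definition word (X : choiceType) : choiceType := seq (X * bool)%type.

Definition word_inv (X : choiceType) (w : word X) : word X :=
  rev [seq (l.1, ~~ l.2) | l <- w].

(* The smallest congruence on words containing free cancellation and the
   relations u = v with R u v.  The quotient of the monoid of words by it is
   the free group on X modulo the normal closure of the elements u v^-1. *)
Inductive pres_eq (X : choiceType) (R : word X -> word X -> Prop) :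
    word X -> word X -> Prop :=
| pres_eq_refl u : pres_eq R u u
| pres_eq_sym u v : pres_eq R u v -> pres_eq R v u
| pres_eq_trans u v w : pres_eq R u v -> pres_eq R v w -> pres_eq R u w
| pres_eq_cat u u' v v' :
    pres_eq R u u' -> pres_eq R v v' -> pres_eq R (u ++ v) (u' ++ v')
| pres_eq_cancel x b : pres_eq R [:: (x, b); (x, ~~ b)] [::]
| pres_eq_rel u v : R u v -> pres_eq R u v.

Section PresentedGroup.
Variables (X : choiceType) (R : word X -> word X -> Prop).

Definition pres_eqb : rel (word X) := fun u v => `[< pres_eq R u v >].

Lemma pres_eqb_refl : reflexive pres_eqb.
Proof. by move=> u; apply/asboolP; exact: pres_eq_refl. Qed.

Lemma pres_eqb_sym : symmetric pres_eqb.
Proof.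
by move=> u v; apply/asboolP/asboolP => h; exact: pres_eq_sym.
Qed.

Lemma pres_eqb_trans : transitive pres_eqb.
Proof.
move=> v u w /asboolP huv /asboolP hvw; apply/asboolP.
exact: pres_eq_trans huv hvw.
Qed.

Canonical pres_equiv := EquivRel pres_eqb
  pres_eqb_refl pres_eqb_sym pres_eqb_trans.

Definition presented := {eq_quot pres_equiv}.

HB.instance Definition _ := Choice.on presented.
HB.instance Definition _ := Quotient.on presented.

Lemma presentedP (u v : word X) :
  \pi_presented u = \pi_presented v <-> pres_eq R u v.
Proof.
split=> [/eqP | h]; last by apply/eqP; rewrite eqmodE; apply/asboolP.
by rewrite eqmodE => /asboolP.
Qed.

Definition presented_one : presented := \pi_presented [::].
Definition presented_mul (g h : presented) : presented :=
  \pi_presented (repr g ++ repr h).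
Definition presented_inv (g : presented) : presented :=
  \pi_presented (word_inv (repr g)).

Lemma word_inv_cat (u v : word X) :
  word_inv (u ++ v) = word_inv v ++ word_inv u :> word X.
Proof. by rewrite /word_inv map_cat rev_cat. Qed.

Lemma pres_eq_mulV u : pres_eq R (word_inv u ++ u) [::].
Proof.
elim: u => [|[x b] u IH]; first exact: pres_eq_refl.
rewrite -cat1s word_inv_cat -catA [_ ++ ([:: _] ++ u)]catA.
apply: pres_eq_trans IH; apply: pres_eq_cat; first exact: pres_eq_refl.
rewrite -[X in pres_eq _ _ X]cat0s; apply: pres_eq_cat (pres_eq_refl _ _).
by have := pres_eq_cancel R x (~~ b); rewrite negbK.
Qed.

Lemma pres_eq_mulrV u : pres_eq R (u ++ word_inv u) [::].
Proof.
elim/last_ind: u => [|u [x b] IH]; first exact: pres_eq_refl.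
rewrite -cats1 word_inv_cat -catA [[:: _] ++ _]catA.
apply: pres_eq_trans IH; apply: pres_eq_cat; first exact: pres_eq_refl.
rewrite -[X in pres_eq _ _ X]cat0s; apply: pres_eq_cat (pres_eq_refl _ _).
exact: pres_eq_cancel.
Qed.

Lemma pres_eq_inv u v : pres_eq R u v -> pres_eq R (word_inv u) (word_inv v).
Proof.
move=> h; apply: (@pres_eq_trans _ _ _ (word_inv u ++ (v ++ word_inv v))).
  rewrite -[X in pres_eq _ X _]cats0; apply: pres_eq_cat.
    exact: pres_eq_refl.
  exact/pres_eq_sym/pres_eq_mulrV.
rewrite catA -[X in pres_eq _ _ X]cat0s.
apply: pres_eq_cat (pres_eq_refl _ _).
apply: pres_eq_trans (pres_eq_mulV u); apply: pres_eq_cat (pres_eq_sym h).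
exact: pres_eq_refl.
Qed.

Lemma repr_presented u : pres_eq R (repr (\pi_presented u)) u.
Proof. by apply/presentedP; rewrite reprK. Qed.

Lemma presented_mulE u v :
  presented_mul (\pi_presented u) (\pi_presented v) = \pi_presented (u ++ v).
Proof. by apply/presentedP; apply: pres_eq_cat; exact: repr_presented. Qed.

Lemma presented_invE u :
  presented_inv (\pi_presented u) = \pi_presented (word_inv u).
Proof. by apply/presentedP; apply: pres_eq_inv; exact: repr_presented. Qed.

Lemma presented_pi (g : presented) : exists u, g = \pi_presented u.
Proof. by exists (repr g); rewrite reprK. Qed.

Lemma presented_mulA : associative presented_mul.
Proof.
move=> f g h; have [u ->] := presented_pi f; have [v ->] := presented_pi g.
have [w ->] := presented_pi h.
by rewrite !presented_mulE catA.
Qed.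

Lemma presented_mul1 : left_id presented_one presented_mul.
Proof.
by move=> g; have [u ->] := presented_pi g; rewrite presented_mulE cat0s. Qed.

Lemma presented_mulr1 : right_id presented_one presented_mul.
Proof.
by move=> g; have [u ->] := presented_pi g; rewrite presented_mulE cats0. Qed.

Lemma presented_mulV : left_inverse presented_one presented_inv presented_mul.
Proof.
move=> g; have [u ->] := presented_pi g.
by rewrite presented_invE presented_mulE; apply/presentedP/pres_eq_mulV.
Qed.

Lemma presented_mulrV : right_inverse presented_one presented_inv presented_mul.
Proof.
move=> g; have [u ->] := presented_pi g.
by rewrite presented_invE presented_mulE; apply/presentedP/pres_eq_mulrV.
Qed.

HB.instance Definition _ := isGroup.Build presented
  presented_mulA presented_mul1 presented_mulr1 presented_mulV presented_mulrV.

Definition pres_gen (x : X) : presented := \pi_presented [:: (x, true)].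

End PresentedGroup.

(* The group G has the presentation < X | R >, the generator x being the
   element f x of G. *)
Definition has_presentation (G : groupType) (X : choiceType)
    (R : word X -> word X -> Prop) (f : X -> G) : Prop :=
  exists phi : {multiplicative presented R -> G},
    bijective phi /\ forall x : X, phi (pres_gen R x) = f x.

Definition idx (n : nat) : choiceType := {i : nat | 0 < i < n}.

Definition far (i j : nat) : bool := (i + 2 <= j) || (j + 2 <= i).

(* inl i is the flat generator c_i, inr i the virtual generator v_i. *)
Definition fv_gens (n : nat) : choiceType := (idx n + idx n)%type.

Section FlatVirtualBraidGroup.
Variable n : nat.
Local Notation c i := (inl i, true).
Local Notation v i := (inr i, true).

Inductive fv_rel : word (fv_gens n) -> word (fv_gens n) -> Prop :=
| fv_cc (i : idx n) : fv_rel [:: c i; c i] [::]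
| fv_ccc (i j : idx n) : sval j = sval i + 1 ->
    fv_rel [:: c i; c j; c i] [:: c j; c i; c j]
| fv_cc_far (i j : idx n) : far (sval i) (sval j) ->
    fv_rel [:: c i; c j] [:: c j; c i]
| fv_vv (i : idx n) : fv_rel [:: v i; v i] [::]
| fv_vvv (i j : idx n) : sval j = sval i + 1 ->
    fv_rel [:: v i; v j; v i] [:: v j; v i; v j]
| fv_vv_far (i j : idx n) : far (sval i) (sval j) ->
    fv_rel [:: v i; v j] [:: v j; v i]
| fv_cv_far (i j : idx n) : far (sval i) (sval j) ->
    fv_rel [:: c i; v j] [:: v j; c i]
| fv_vcv (i j : idx n) : sval j = sval i + 1 ->
    fv_rel [:: v i; c j; v i] [:: v j; c i; v j].

Definition FV : groupType := presented fv_rel.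

Definition fv_c (i : idx n) : FV := pres_gen fv_rel (inl i).
Definition fv_v (i : idx n) : FV := pres_gen fv_rel (inr i).

End FlatVirtualBraidGroup.

(* inl tt is the generator c_1, inr i the generator v_i. *)
Definition red_gens (n : nat) : choiceType := (unit + idx n)%type.

Section ReducedPresentation.
Variable n : nat.
Local Notation c1 := (inl tt, true).
Local Notation v i := (inr i, true).

(* i1, i2, i3 stand for the indices 1, 2, 3; a relation in which they occur is
   present only when these belong to idx n. *)
Inductive red_rel : word (red_gens n) -> word (red_gens n) -> Prop :=
| red_vvv (i j : idx n) : sval j = sval i + 1 ->
    red_rel [:: v i; v j; v i] [:: v j; v i; v j]
| red_vv_comm (i j : idx n) : sval j <> sval i + 1 -> sval i <> sval j + 1 ->
    red_rel [:: v i; v j] [:: v j; v i]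
| red_cc : red_rel [:: c1; c1] [::]
| red_vv (i : idx n) : red_rel [:: v i; v i] [::]
| red_cv (j : idx n) : 2 < sval j ->
    red_rel [:: c1; v j] [:: v j; c1]
| red_braid (i1 i2 : idx n) : sval i1 = 1 -> sval i2 = 2 ->
    red_rel
      ([:: v i1; c1; v i1] ++ [:: v i2; c1; v i2] ++ [:: v i1; c1; v i1])
      ([:: v i2; c1; v i2] ++ [:: v i1; c1; v i1] ++ [:: v i2; c1; v i2])
| red_comm (i1 i2 i3 : idx n) : sval i1 = 1 -> sval i2 = 2 -> sval i3 = 3 ->
    let w := [:: v i2; v i3; v i1; v i2; c1; v i2; v i1; v i3; v i2] in
    red_rel (c1 :: w) (rcons w c1).

Definition idx1 (hn : 2 <= n) : idx n :=
  exist (fun i => 0 < i < n) 1 hn.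

Definition red_to_FV (hn : 2 <= n) (x : red_gens n) : FV n :=
  match x with
  | inl _ => fv_c (idx1 hn)
  | inr i => fv_v i
  end.

End ReducedPresentation.

(* Main.v *)
Require Import Defs.
From HB Require Import structures.
From mathcomp Require Import all_boot.
From mathcomp Require Import zify.

(** The two presentations are related by Tietze transformations.  In FV_n the
    mixed relation v_i c_{i+1} v_i = v_{i+1} c_i v_{i+1} says exactly that
    c_{i+1} is the conjugate of c_i by v_{i+1} v_i, so that c_1 and the v_i
    generate, and each reduced relation is a relation of FV_n rewritten with
    this formula: after conjugation by v_1 the long relation of degree three is
    c_1 c_2 c_1 = c_2 c_1 c_2 ([red_braidE]), and the word
    v_2 v_3 v_1 v_2 c_1 v_2 v_1 v_3 v_2 is c_3 ([red_commE]).

    Conversely, in a group satisfying the reduced relations let [flat] be the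
    sequence defined from c_1 by that recursion.  The mixed relation holds by
    construction, and the other relations of FV_n spread from the first indices
    to all indices by conjugation:
    - c_i commutes with v_j for far i and j ([flat_virtual_far]); the only case
      with content is j = i - 2, where two steps of the recursion are needed:
      they express c_i as a conjugate of c_{i-2}, and the same conjugation
      takes v_i, which commutes with c_{i-2}, to v_{i-2} ([braid_slide]);
    - c_i and c_j commute for far i and j ([flat_flat_far]): a conjugator that
      raises one of the indices fixes the other letter, so everything reduces
      to c_1 and c_3;
    - the braid relation for c_i, c_{i+1} ([flat_braid]): the single element
      v_{i+2} v_{i+1} v_i conjugates the pair (c_i, c_{i+1}) to
      (c_{i+1}, c_{i+2}).

    The two resulting homomorphisms fix the generators, hence are inverse to
    each other ([has_presentation_inverse]). *)

Set Implicit Arguments.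
Unset Strict Implicit.
Unset Printing Implicit Defensive.

Local Open Scope group_scope.

(** * Homomorphisms out of a presented group *)

Section WordValue.
Variables (X : choiceType) (G : groupType) (f : X -> G).

Definition word_value (w : word X) : G :=
  foldr (fun l g => (if l.2 then f l.1 else (f l.1)^-1) * g) 1 w.

Lemma word_value_cat u w : word_value (u ++ w) = word_value u * word_value w.
Proof. by elim: u => [|l u IH] /=; rewrite ?mul1g // IH mulgA. Qed.

Definition satisfies (R : word X -> word X -> Prop) : Prop :=
  forall u w, R u w -> word_value u = word_value w.

Lemma word_value_pres_eq R u w :
  satisfies R -> pres_eq R u w -> word_value u = word_value w.
Proof.
move=> fR; elim=> //.
- by move=> {}u {}w y _ -> _ ->.
- by move=> {}u u' {}w w' _ eq_u _ eq_w; rewrite !word_value_cat eq_u eq_w.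
- by move=> x [] /=; rewrite mulg1 ?mulgV ?mulVg.
Qed.

End WordValue.

Section Lift.
Variables (X : choiceType) (R : word X -> word X -> Prop).

Section Existence.
Variables (G : groupType) (f : X -> G) (fR : satisfies f R).

(** The proof that [f] respects the relations is made an argument, so that the
    multiplicative structure of [lift] can be inferred from the term alone. *)
Definition lift (g : presented R) : G :=
  let _ := fR in word_value f (repr g).

Lemma lift_pi u : lift (\pi_(presented R)%qT u) = word_value f u.
Proof. exact: word_value_pres_eq fR (repr_presented R u). Qed.

Lemma lift_gen x : lift (pres_gen R x) = f x.
Proof. by rewrite lift_pi /= mulg1. Qed.

Lemma liftM : {morph lift : g h / g * h}.
Proof.
move=> g h; have [u ->] := presented_pi g; have [w ->] := presented_pi h.
by rewrite [X in lift X]presented_mulE !lift_pi word_value_cat.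
Qed.

HB.instance Definition _ := isMultiplicative.Build _ _ lift liftM.

End Existence.
End Lift.

Section Multiplicative.
Variables (G H : groupType) (phi : {multiplicative G -> H}).

Lemma multiplicative_one : phi 1 = 1.
Proof. by apply: (mulgI (phi 1)); rewrite -gmulfM !mulg1. Qed.

Lemma multiplicative_inv x : phi x^-1 = (phi x)^-1.
Proof.
by apply: (mulgI (phi x)); rewrite -gmulfM !mulgV multiplicative_one.
Qed.

Lemma multiplicative_word_value (X : choiceType) (f : X -> G) w :
  phi (word_value f w) = word_value (phi \o f) w.
Proof.
elim: w => [|[x b] w IH] /=; first exact: multiplicative_one.
by rewrite gmulfM IH; case: b; rewrite ?multiplicative_inv.
Qed.

End Multiplicative.

Lemma word_value_pres_gen (X : choiceType) (R : word X -> word X -> Prop) u :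
  word_value (pres_gen R) u = \pi_(presented R)%qT u.
Proof.
elim: u => [//|[x b] u IH] /=; rewrite IH -cat1s -presented_mulE.
by case: b => //; congr (_ * _); exact: presented_invE.
Qed.

Lemma pres_gen_satisfies (X : choiceType) (R : word X -> word X -> Prop) :
  satisfies (pres_gen R) R.
Proof.
by move=> u w Ruw; rewrite !word_value_pres_gen; apply/presentedP/pres_eq_rel.
Qed.

Lemma multiplicative_gen_id (X : choiceType) (R : word X -> word X -> Prop)
    (phi : {multiplicative presented R -> presented R}) :
  (forall x, phi (pres_gen R x) = pres_gen R x) -> phi =1 id.
Proof.
move=> phi_gen g; have [u ->] := presented_pi g.
rewrite -word_value_pres_gen multiplicative_word_value.
by elim: u => //= l u ->; rewrite phi_gen.
Qed.

(** Both composites are endomorphisms fixing the generators, so the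
    identity; it is enough to test them there. *)
Lemma has_presentation_inverse (X Y : choiceType)
    (R : word X -> word X -> Prop) (S : word Y -> word Y -> Prop)
    (f : X -> presented S) (g : Y -> presented R)
    (fR : satisfies f R) (gS : satisfies g S) :
  (forall x, lift gS (f x) = pres_gen R x) ->
  (forall y, lift fR (g y) = pres_gen S y) ->
  has_presentation R f.
Proof.
move=> gfK fgK; exists (lift fR); split; last exact: lift_gen.
exists (lift gS).
- by apply: (multiplicative_gen_id (phi := lift gS \o lift fR)) => x /=;
    rewrite lift_gen.
- by apply: (multiplicative_gen_id (phi := lift fR \o lift gS)) => y /=;
    rewrite lift_gen.
Qed.

(** * The sequence of flat generators in a group *)

Section Flat.
Variable G : groupType.

Lemma commute_conjg (x y : G) : commute x y <-> x ^ y = x.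
Proof.
rewrite conjgE; split=> [->|eq_x]; first by rewrite mulKg.
by rewrite /commute -[in RHS]eq_x mulVKg.
Qed.

Lemma commute_conj2 (x y z : G) : commute x y -> commute (x ^ z) (y ^ z).
Proof. by rewrite /commute -!conjMg => ->. Qed.

Lemma involution_inv (x : G) : x * x = 1 -> x^-1 = x.
Proof. exact: mulg1_eq. Qed.

(** For the standard generators of the braid group on four strands, b a d b
    moves the first two strands past the last two, so it carries the crossing a
    of one pair to the crossing d of the other. *)
Lemma braid_slide (a b d : G) :
  a * b * a = b * a * b -> b * d * b = d * b * d -> commute a d ->
  b * a * d * b * a = d * (b * a * d * b).
Proof.
move=> ab bd ad.
rewrite -(mulgA b a d) ad mulgA -(mulgA _ a b) -(mulgA _ (a * b) a) ab.
by rewrite !mulgA bd -!mulgA [d * (a * _)]mulgA -ad !mulgA.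
Qed.

(** The sequence starts at index 1; the value at 0 is a dummy, chosen so that
    [flat_flat] holds there too. *)
Fixpoint flat (v : nat -> G) (c : G) (i : nat) : G :=
  if i is i'.+1 then if i' is 0 then c else flat v c i' ^ (v i'.+1 * v i')
  else c.

Section Reduced.
Variables (n : nat) (v : nat -> G) (c : G).
Hypothesis vv : forall i, v i * v i = 1.
Hypothesis vv_far : forall i j, far i j -> commute (v i) (v j).
Hypothesis vvv : forall i, 0 < i -> i.+1 < n ->
  v i * v i.+1 * v i = v i.+1 * v i * v i.+1.
Hypothesis cc : c * c = 1.
Hypothesis cv : forall j, 2 < j -> commute c (v j).

Local Notation C := (flat v c).

Lemma flatS i : 0 < i -> C i.+1 = C i ^ (v i.+1 * v i).
Proof. by case: i. Qed.

Lemma flat_flat i : C i * C i = 1.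
Proof.
elim: i => [|[|i] IH] //.
by rewrite flatS // -conjMg IH conj1g.
Qed.

(** For i > 1 there are two cases.  If j is also far from i - 1, then v_j
    commutes with c_{i-1} and with the conjugator v_i v_{i-1}.  Otherwise
    j = i - 2, and c_i is the conjugate of c_{i-2} by
    v_{i-1} v_{i-2} v_i v_{i-1}, an element that conjugates v_i to v_{i-2};
    so the claim for (i, i - 2) follows from the one for (i - 2, i). *)
Lemma flat_virtual_far i j :
  0 < i < n -> 0 < j -> far i j -> commute (C i) (v j).
Proof.
elim/ltn_ind: i j => -[|[|i]] // IH j lt_in j_gt0; rewrite /far => far_ij.
  by apply: cv; lia.
have [|far_j] := eqVneq j i.
  case: i => [|i] in IH lt_in far_ij *;
    first by move=> j0; move: j_gt0; rewrite j0.
  move=> ->; apply/commute_conjg; rewrite 2?flatS // -!conjgM !mulgA.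
  rewrite braid_slide ?vvv //; try by lia.
    rewrite conjgM; congr (_ ^ _); apply/commute_conjg.
    by apply: IH => //; rewrite /far; lia.
  by apply: vv_far; rewrite /far; lia.
apply/commute_conjg; rewrite flatS // -conjgM.
have -> : v i.+2 * v i.+1 * v j = v j * (v i.+2 * v i.+1).
  by symmetry; apply: commuteM; apply: vv_far; rewrite /far; lia.
rewrite conjgM; congr (_ ^ _); apply/commute_conjg.
by apply: IH; rewrite /far; lia.
Qed.

(** A conjugator that lowers one index fixes the other letter: v_{i-1} and v_i
    commute with c_j, which brings i down to 1, and v_{j-1} and v_j commute with
    c_1 as long as j > 3. *)
Lemma flat_flat_far i j : (3 < n -> commute (C 1) (C 3)) ->
  0 < i < n -> 0 < j < n -> i + 2 <= j -> commute (C i) (C j).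
Proof.
move=> c13 lt_in lt_jn; elim: i => [|[|i] IH] // in lt_in *.
  elim: j lt_jn {lt_in IH} => [|j IH] lt_jn lt_j; first lia.
  have [j2|j2] := eqVneq j 2; first by rewrite j2 in lt_jn *; apply: c13; lia.
  rewrite (@flatS j); last lia.
  suff -> : C 1 = C 1 ^ (v j.+1 * v j).
    by apply: commute_conj2; apply: IH; lia.
  by symmetry; apply/commute_conjg/commuteM; apply: cv; lia.
move=> lt_j; rewrite (@flatS i.+1) //.
suff -> : C j = C j ^ (v i.+2 * v i.+1).
  by apply: commute_conj2; apply: IH; lia.
symmetry; apply/commute_conjg/commuteM; apply: flat_virtual_far => //;
  rewrite /far; lia.
Qed.

(** Conjugation by v_{i+2} v_{i+1} v_i raises both indices: v_{i+2} commutes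
    with c_i, and v_i with c_{i+2}. *)
Lemma flat_braid i :
  (2 < n -> C 1 * C 2 * C 1 = C 2 * C 1 * C 2) ->
  0 < i -> i.+1 < n -> C i * C i.+1 * C i = C i.+1 * C i * C i.+1.
Proof.
move=> c12; elim: i => [|[|i] IH] // _ lt_in.
pose h := v i.+3 * (v i.+2 * v i.+1).
have -> : C i.+2 = C i.+1 ^ h.
  rewrite /h conjgM flatS //; congr (_ ^ _); symmetry; apply/commute_conjg.
  by apply: flat_virtual_far; rewrite /far; lia.
have -> : C i.+3 = C i.+2 ^ h.
  rewrite /h mulgA conjgM -flatS //; symmetry; apply/commute_conjg.
  by apply: flat_virtual_far; rewrite /far; lia.
by rewrite -!conjMg IH //; lia.
Qed.

Lemma flat_mixed i : v i.+1 * C i.+2 * v i.+1 = v i.+2 * C i.+1 * v i.+2.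
Proof.
rewrite flatS // conjgE invgM !involution_inv // !mulgA.
by rewrite vv mul1g -[X in X = _]mulgA vv mulg1.
Qed.

End Reduced.

Section Relations.
Variables v1 v2 v3 c1 c2 c3 : G.
Hypotheses (vv1 : v1 * v1 = 1) (vv2 : v2 * v2 = 1) (vv3 : v3 * v3 = 1).

Lemma mixed_solve (x y c d : G) : x * x = 1 -> y * y = 1 ->
  x * d * x = y * c * y -> d = x * y * c * y * x.
Proof.
move=> xx yy eq_d; rewrite -(mulgA x) -(mulgA x) -eq_d !mulgA xx mul1g.
by rewrite -[RHS]mulgA xx mulg1.
Qed.

(** Conjugation by v1 takes one relation to the other, as v2 c1 v2 is also the
    conjugate of c2 by v1. *)
Lemma red_braidE : v1 * c2 * v1 = v2 * c1 * v2 ->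
  (v1 * c1 * v1) * (v2 * c1 * v2) * (v1 * c1 * v1) =
    (v2 * c1 * v2) * (v1 * c1 * v1) * (v2 * c1 * v2) <->
  c1 * c2 * c1 = c2 * c1 * c2.
Proof.
move=> <-.
have conjE x : v1 * x * v1 = x ^ v1 by rewrite conjgE involution_inv // mulgA.
by rewrite !conjE -!conjMg; split=> [/conjg_inj|->].
Qed.

Lemma red_commE : v1 * c2 * v1 = v2 * c1 * v2 ->
  v2 * c3 * v2 = v3 * c2 * v3 ->
  v2 * v3 * v1 * v2 * c1 * v2 * v1 * v3 * v2 = c3.
Proof.
move=> /(mixed_solve vv1 vv2) def_c2 /(mixed_solve vv2 vv3) ->.
by rewrite def_c2 !mulgA.
Qed.

End Relations.
End Flat.

Lemma multiplicative_flat (G H : groupType) (phi : {multiplicative G -> H})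
    v v' c i :
  (forall j, phi (v j) = v' j) -> phi (flat v c i) = flat v' (phi c) i.
Proof.
move=> phi_v; elim: i => [|[|i] IH] //.
rewrite flatS // [in RHS]flatS // !conjgE !gmulfM (multiplicative_inv phi).
by rewrite !gmulfM !phi_v IH.
Qed.

(** * Sequences indexed by all natural numbers *)

Definition mkidx n i (lt_in : 0 < i < n) : idx n :=
  exist (fun i => 0 < i < n) i lt_in.

Section Extend.
Variables (n : nat) (G : groupType) (w : idx n -> G).

(** With the value 1 outside the range, the involution and far commutation
    relations hold for all indices; only the braid relation keeps a bound. *)
Definition extend (i : nat) : G := oapp w 1 (insub i).

Lemma extendE (i : idx n) : extend (sval i) = w i.
Proof. by rewrite /extend valK. Qed.

Lemma extend_ind (P : nat -> G -> Prop) :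
  (forall i : idx n, P (sval i) (w i)) -> (forall i, P i 1) ->
  forall i, P i (extend i).
Proof.
by move=> Pw P1 i; rewrite /extend; case: insubP => [j _ <-|_] /=.
Qed.

End Extend.

(** * From the reduced relations to those of the flat virtual braid group *)

Section ReducedToFlat.
Variables (n : nat) (G : groupType) (g : red_gens n -> G).
Hypothesis gR : satisfies g (@red_rel n).

Local Notation c := (g (inl tt)).
Local Notation v := (extend (fun i : idx n => g (inr i))).

Lemma red_vE (i : idx n) : g (inr i) = v (sval i).
Proof. by rewrite extendE. Qed.

Lemma red_v_involution i : v i * v i = 1.
Proof.
apply: (extend_ind (P := fun _ x => x * x = 1)) i => [i|_]; last exact: mulg1.
by have := gR (red_vv i); rewrite /= !mulg1.
Qed.

Lemma red_v_far i j : far i j -> commute (v i) (v j).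
Proof.
apply: (extend_ind (P := fun i x => far i j -> commute x (v j))) i; last first.
  by move=> i _; apply/commute_sym/commute1.
move=> i; apply: (extend_ind (P := fun j y => far _ j -> commute _ y)) j;
  last by move=> j _; apply: commute1.
move=> j; rewrite /far => far_ij.
have := @red_vv_comm n i j.
by move=> /(_ ltac:(lia) ltac:(lia)) /gR; rewrite /= !mulg1.
Qed.

Lemma red_v_braid i : 0 < i -> i.+1 < n ->
  v i * v i.+1 * v i = v i.+1 * v i * v i.+1.
Proof.
move=> i_gt0 lt_in; have lt_i : 0 < i < n by lia.
pose i0 := @mkidx n i lt_i.
pose i1 := @mkidx n i.+1 lt_in.
rewrite -[i.+1]/(sval i1) -[i]/(sval i0) !extendE.
have := @red_vvv n i0 i1 (esym (addn1 _)).
by move/gR; rewrite /= !mulg1 !mulgA.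
Qed.

Lemma red_c_far j : 2 < j -> commute c (v j).
Proof.
apply: (extend_ind (P := fun j x => 2 < j -> commute c x)) j;
  last by move=> j _; apply: commute1.
by move=> j /(@red_cv n j) /gR; rewrite /= !mulg1.
Qed.

Lemma red_c_involution : c * c = 1.
Proof. by have := gR (@red_cc n); rewrite /= !mulg1. Qed.

Local Notation C := (flat v c).

Lemma red_flat_braid : 2 < n -> C 1 * C 2 * C 1 = C 2 * C 1 * C 2.
Proof.
move=> lt2n; have lt1n : 0 < 1 < n by lia.
pose i1 := @mkidx n 1 lt1n.
pose i2 := @mkidx n 2 lt2n.
have braid := gR (@red_braid n i1 i2 erefl erefl).
rewrite /= !mulg1 !red_vE /= !mulgA in braid.
have vv := red_v_involution.
by apply/(red_braidE (vv 1%N) (flat_mixed c vv 0)); rewrite !mulgA.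
Qed.

Lemma red_flat_comm : 3 < n -> commute (C 1) (C 3).
Proof.
move=> lt3n; have [lt1n lt2n] : 0 < 1 < n /\ 0 < 2 < n by lia.
pose i1 := @mkidx n 1 lt1n.
pose i2 := @mkidx n 2 lt2n.
pose i3 := @mkidx n 3 lt3n.
have comm := gR (@red_comm n i1 i2 i3 erefl erefl erefl).
rewrite /= !mulg1 !red_vE /= !mulgA in comm.
have vv := red_v_involution.
have <- := red_commE (vv 1%N) (vv 2%N) (vv 3%N)
  (flat_mixed c vv 0) (flat_mixed c vv 1).
by rewrite /commute !mulgA.
Qed.

Definition flat_gens (y : fv_gens n) : G :=
  match y with inl i => C (sval i) | inr i => g (inr i) end.

Lemma flat_gens_satisfies : satisfies flat_gens (@fv_rel n).
Proof.
have vv := red_v_involution; have vf := red_v_far; have vb := red_v_braid.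
have cv := red_c_far.
have c_far (i j : idx n) : sval i + 2 <= sval j ->
    commute (C (sval i)) (C (sval j)).
  by have := flat_flat_far vf vb cv red_flat_comm (valP i) (valP j).
move=> _ _ [i|i j ij|i j ij|i|i j ij|i j ij|i j ij|i j ij];
  rewrite /= !mulg1 ?mulgA ?red_vE ?ij ?addn1.
- exact: flat_flat red_c_involution _.
- have /= := valP j; have /= := valP i; rewrite ij addn1 => /andP[? _] ?.
  exact: (flat_braid vf vb cv red_flat_braid).
- by case/orP: ij => /c_far // /commute_sym.
- exact: vv.
- have /= := valP j; have /= := valP i; rewrite ij addn1 => /andP[? _] ?.
  exact: vb.
- exact: vf.
- have /= := valP j; have /= := valP i => ? /andP[? _].
  exact: (flat_virtual_far vf vb cv).
- have /= /andP[] := valP i; case: (sval i) => // k _ _; exact: flat_mixed.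
Qed.

End ReducedToFlat.

(** * From the relations of the flat virtual braid group to the reduced ones *)

Section FlatToReduced.
Variables (n : nat) (hn : 2 <= n) (G : groupType) (h : fv_gens n -> G).
Hypothesis hS : satisfies h (@fv_rel n).

Local Notation c i := (h (inl i)).
Local Notation v i := (h (inr i)).

Lemma fv_v_involution i : v i * v i = 1.
Proof. by have := hS (fv_vv i); rewrite /= !mulg1. Qed.

Lemma fv_mixed (i j : idx n) : sval j = sval i + 1 ->
  v i * c j * v i = v j * c i * v j.
Proof. by move/fv_vcv/hS; rewrite /= !mulg1 !mulgA. Qed.

Lemma fv_flat_braid (i j : idx n) : sval j = sval i + 1 ->
  c i * c j * c i = c j * c i * c j.
Proof. by move/fv_ccc/hS; rewrite /= !mulg1 !mulgA. Qed.

(** This is the elimination of the generators c_2, c_3, up to c_{n-1}: the mixed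
    relation is the recursion that defines [flat]. *)
Lemma fv_flatE i : c i = flat (extend (fun i => v i)) (c (idx1 hn)) (sval i).
Proof.
case: i => i lt_in; rewrite [RHS]/=.
elim: i lt_in => [|[|i] IH] lt_in //.
  by congr (h (inl _)); exact: val_inj.
have lt_i : 0 < i.+1 < n by lia.
rewrite flatS // -(IH lt_i).
pose i0 := mkidx lt_i.
pose i1 := mkidx lt_in.
have i01 : sval i1 = sval i0 + 1 by rewrite addn1.
rewrite -[i.+2]/(sval i1) -[i.+1]/(sval i0) !extendE.
have vv := fv_v_involution.
rewrite (mixed_solve (vv i0) (vv i1) (fv_mixed i01)).
by rewrite conjgE invgM !involution_inv // !mulgA.
Qed.

Definition reduced_gens (x : red_gens n) : G :=
  match x with inl _ => c (idx1 hn) | inr i => v i end.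

Lemma reduced_gens_satisfies : satisfies reduced_gens (@red_rel n).
Proof.
have vv := fv_v_involution.
move=> _ _ [i j ij|i j ij ji||i|j j2|i1 i2 e1 e2|i1 i2 i3 e1 e2 e3 w].
- by have := hS (fv_vvv ij).
- have [lt_ij|lt_ji|eq_ij] := ltngtP (sval i) (sval j); last first.
    by rewrite (val_inj eq_ij).
  + have far_ij : far (sval i) (sval j) by rewrite /far; lia.
    exact: (hS (fv_vv_far far_ij)).
  + have far_ij : far (sval i) (sval j) by rewrite /far; lia.
    exact: (hS (fv_vv_far far_ij)).
- exact: (hS (fv_cc _)).
- exact: (hS (fv_vv i)).
- have far_1j : far (sval (idx1 hn)) (sval j) by apply/orP; left.
  exact: (hS (fv_cv_far far_1j)).
- have e12 : sval i2 = sval i1 + 1 by rewrite e1 e2.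
  have c1E : c (idx1 hn) = c i1 by congr (h (inl _)); exact: val_inj.
  rewrite /= c1E !mulg1 ?mulgA; have := fv_flat_braid e12.
  by move/(red_braidE (vv i1) (fv_mixed e12)); rewrite !mulgA.
- have e12 : sval i2 = sval i1 + 1 by rewrite e1 e2.
  have e23 : sval i3 = sval i2 + 1 by rewrite e2 e3.
  have far13 : far (sval i1) (sval i3) by rewrite e1 e3.
  have c1E : c (idx1 hn) = c i1 by congr (h (inl _)); exact: val_inj.
  have := hS (fv_cc_far far13); rewrite /= c1E !mulg1.
  rewrite -(red_commE (vv i1) (vv i2) (vv i3) (fv_mixed e12) (fv_mixed e23)).
  by rewrite !mulgA.
Qed.

End FlatToReduced.

(** * The reduced presentation *)

Theorem theorem3 (n : nat) (hn : 2 <= n) :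
  has_presentation (@red_rel n) (red_to_FV hn).
Proof.
have S_gen := @pres_gen_satisfies _ (@fv_rel n).
have R_gen := @pres_gen_satisfies _ (@red_rel n).
have fR : satisfies (red_to_FV hn) (@red_rel n).
  exact: (reduced_gens_satisfies hn S_gen).
apply: (has_presentation_inverse (fR := fR) (gS := flat_gens_satisfies R_gen)).
- case=> [[]|i]; first by rewrite lift_gen.
  by rewrite lift_gen.
- case=> i; last by rewrite lift_gen.
  pose w i := pres_gen (@red_rel n) (inr i).
  have lift_v j : lift fR (extend w j) = extend (@fv_v n) j.
    by rewrite /extend; case: insub => [k|];
      rewrite ?lift_gen ?multiplicative_one.
  rewrite [RHS](fv_flatE hn S_gen) /= (multiplicative_flat _ _ lift_v).
  by congr (flat _ _ _); exact: lift_gen.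
Qed.
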